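(* For any two closed ACP terms $t$ and $t'$, if $t = t'$ is derivable from the axioms of siACP, then $t = t'$ is derivable from the axioms of ACP.
   Context: ACP: fix a set $A$ of actions with $\delta \notin A$, $A_\delta = A \cup \{\delta\}$, and a commutative, associative $\gamma: A_\delta \times A_\delta \to A_\delta$ with $\gamma(\delta,a)=\delta$. Signature: constants $a$ ($a\in A$), $\delta$; binary $+$, $\cdot$, $\parallel$, $\lfloor\!\lfloor$ (left merge), $\mid$ (communication merge); unary $\partial_H$ ($H\subseteq A$). Axioms ($a,b$ range over constants from $A_\delta$): A1 $x+y=y+x$; A2 $(x+y)+z=x+(y+z)$; A3 $x+x=x$; A4 $(x+y)\cdot z = x\cdot z+y\cdot z$; A5 $(x\cdot y)\cdot z = x\cdot(y\cdot z)$; A6 $x+\delta=x$; A7 $\delta\cdot x=\delta$; D1 $\partial_H(a)=a$ if $a\notin H$; D2 $\partial_H(a)=\delta$ if $a\in H$; D3 $\partial_H(x+y)=\partial_H(x)+\partial_H(y)$; D4 $\partial_H(x\cdot y)=\partial_H(x)\cdot\partial_H(y)$; CM1 $x\parallel y = x\lfloor\!\lfloor y + y\lfloor\!\lfloor x + x\mid y$; CM2 $a\lfloor\!\lfloor x = a\cdot x$; CM3 $a\cdot x\lfloor\!\lfloor y = a\cdot(x\parallel y)$; CM4 $(x+y)\lfloor\!\lfloor z = x\lfloor\!\lfloor z + y\lfloor\!\lfloor z$; CM5 $a\cdot x\mid b = \gamma(a,b)\cdot x$; CM6 $a\mid b\cdot x=\gamma(a,b)\cdot x$; CM7 $a\cdot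 x\mid b\cdot y = \gamma(a,b)\cdot(x\parallel y)$; CM8 $(x+y)\mid z = x\mid z+y\mid z$; CM9 $x\mid(y+z)=x\mid y+x\mid z$; CM10 $\delta\mid x=\delta$; CM11 $x\mid\delta=\delta$; CM12 $a\mid b=\gamma(a,b)$. siACP (same $A$ and $\gamma$): $\mathbb{N}^+$ denotes the positive naturals. The set $\mathcal{H}$ of interleaving histories is the subset of $(\mathbb{N}^+\times\mathbb{N}^+)^*$ defined inductively by: the empty sequence is in $\mathcal{H}$; $\langle i,n\rangle\in\mathcal{H}$ if $i\le n$; if $h\frown\langle i,n\rangle\in\mathcal{H}$, $j\le n$ and $n-1\le m\le n+1$, then $h\frown\langle i,n\rangle\frown\langle j,m\rangle\in\mathcal{H}$. Given are a set $S$ of control states, for each $n\in\mathbb{N}^+$ functions $\mathrm{sched}_n:\mathcal{H}\times S\to\{1,\dots,n\}$ and $\mathrm{upd}_n:\mathcal{H}\times S\times\{1,\dots,n\}\times A\to S$, a set $D$ of data, and a function $\mathrm{cr}$ from $D$ to the set of closed siACP terms; for each $d\in D$ there are actions $\mathrm{pcr}(d),\mathrm{rcr}(d)\in A$ with $\gamma(\mathrm{pcr}(d),a)=\delta$ and $\gamma(a,b)\ne\mathrm{pcr}(d)$ for all $a,b\in A$. The signature of siACP is that of ACP plus, for each $n\in\mathbb{N}^+$, $h\in\mathcal{H}$, $s\in S$, an $n$-ary operator $\|^n_{h,s}$, and for each $n,i\in\mathbb{N}^+$, $i\le n$, $h\in\mathcal{H}$, $s\in S$, an $n$-ary operator $\pi^n_{i,h,s}$.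 Its axioms are those of ACP plus (with $n,i\in\mathbb{N}^+$, $i\le n$, $h\in\mathcal{H}$, $s\in S$, $d\in D$, $a$ any action constant from $A$ not of the form $\mathrm{pcr}(d)$ or $\mathrm{rcr}(d)$): SI1 $\|^n_{h,s}(x_1,\dots,x_n)=\pi^n_{\mathrm{sched}_n(h,s),h,s}(x_1,\dots,x_n)$; SI2 $\pi^n_{i,h,s}(x_1,\dots,x_{i-1},\delta,x_{i+1},\dots,x_n)=\delta$; SI3 $\pi^1_{i,h,s}(a)=a$; SI4 $\pi^{n+1}_{i,h,s}(x_1,\dots,x_{i-1},a,x_{i+1},\dots,x_{n+1}) = a\cdot\|^n_{h\frown\langle i,n\rangle,\mathrm{upd}_{n+1}(h,s,i,a)}(x_1,\dots,x_{i-1},x_{i+1},\dots,x_{n+1})$; SI5 $\pi^n_{i,h,s}(x_1,\dots,x_{i-1},a\cdot x'_i,x_{i+1},\dots,x_n) = a\cdot\|^n_{h\frown\langle i,n\rangle,\mathrm{upd}_n(h,s,i,a)}(x_1,\dots,x_{i-1},x'_i,x_{i+1},\dots,x_n)$; SI6 $\pi^n_{i,h,s}(x_1,\dots,x_{i-1},\mathrm{pcr}(d),x_{i+1},\dots,x_n) = \mathrm{rcr}(d)\cdot\|^n_{h\frown\langle i,n\rangle,\mathrm{upd}_n(h,s,i,\mathrm{pcr}(d))}(x_1,\dots,x_{i-1},x_{i+1},\dots,x_n,\mathrm{cr}(d))$; SI7 $\pi^n_{i,h,s}(x_1,\dots,x_{i-1},\mathrm{pcr}(d)\cdot x'_i,x_{i+1},\dots,x_n)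 = \mathrm{rcr}(d)\cdot\|^{n+1}_{h\frown\langle i,n+1\rangle,\mathrm{upd}_n(h,s,i,\mathrm{pcr}(d))}(x_1,\dots,x_{i-1},x'_i,x_{i+1},\dots,x_n,\mathrm{cr}(d))$; SI8 $\pi^n_{i,h,s}(x_1,\dots,x_{i-1},x'_i+x''_i,x_{i+1},\dots,x_n) = \pi^n_{i,h,s}(x_1,\dots,x'_i,\dots,x_n)+\pi^n_{i,h,s}(x_1,\dots,x''_i,\dots,x_n)$.
   Formalization: It is additionally assumed that distinct data d give distinct process creation actions pcr(d); without this, two data sharing pcr and rcr but with cr(d)=a, cr(d')=b make r·a = r·b derivable in siACP but not in ACP. *)

(* Defs.v *)
From mathcomp Require Import all_boot.

Set Implicit Arguments.
Unset Strict Implicit.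
Unset Printing Implicit Defensive.

Record signature := Signature { op : Type; arity : op -> nat }.

(* Terms over the operators of ACP and the additional operators of [X].
   A_delta is [option A], where [None] is delta. *)
Inductive term (A : Type) (X : signature) : Type :=
| Var (v : nat)
| Const (a : option A)
| Alt (x y : term A X)
| Seq (x y : term A X)
| Merge (x y : term A X)
| LMerge (x y : term A X)
| Comm (x y : term A X)
| Encap (H : A -> Prop) (x : term A X)
| Op (o : op X) (x : 'I_(arity o) -> term A X).

Arguments Var {A X} v.
Arguments Const {A X} a.
Arguments Op {A X} o x.

Declare Scope process_scope.
Delimit Scope process_scope with proc.
Local Open Scope process_scope.
Notation "x + y" := (Alt x y) : process_scope.
Notation "x * y" := (Seq x y) : process_scope.
Notation delta := (Const None).
Notation Act a := (Const (Some a)).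

Fixpoint is_closed A X (t : term A X) : Prop :=
  match t with
  | Var _ => False
  | Const _ => True
  | Alt x y | Seq x y | Merge x y | LMerge x y | Comm x y =>
      is_closed x /\ is_closed y
  | Encap _ x => is_closed x
  | Op _ x => forall k, is_closed (x k)
  end.

Definition acp_signature := Signature (of_void nat).
Definition acp_term A := term A acp_signature.

Fixpoint embed A X (t : acp_term A) : term A X :=
  match t with
  | Var v => Var v
  | Const a => Const a
  | Alt x y => Alt (embed X x) (embed X y)
  | Seq x y => Seq (embed X x) (embed X y)
  | Merge x y => Merge (embed X x) (embed X y)
  | LMerge x y => LMerge (embed X x) (embed X y)
  | Comm x y => Comm (embed X x) (embed X y)
  | Encap H x => Encap H (embed X x)
  | Op o _ => of_void (term A X) o
  end.

(* [ax] is meant to relate the two sides of all substitution instances of the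
   axioms, so that no separate substitution rule is needed. *)
Inductive derivable A X (ax : term A X -> term A X -> Prop) :
  term A X -> term A X -> Prop :=
| der_ax x y : ax x y -> derivable ax x y
| der_refl x : derivable ax x x
| der_sym x y : derivable ax x y -> derivable ax y x
| der_trans x y z : derivable ax x y -> derivable ax y z -> derivable ax x z
| der_Alt x x' y y' : derivable ax x x' -> derivable ax y y' ->
    derivable ax (Alt x y) (Alt x' y')
| der_Seq x x' y y' : derivable ax x x' -> derivable ax y y' ->
    derivable ax (Seq x y) (Seq x' y')
| der_Merge x x' y y' : derivable ax x x' -> derivable ax y y' ->
    derivable ax (Merge x y) (Merge x' y')
| der_LMerge x x' y y' : derivable ax x x' -> derivable ax y y' ->
    derivable ax (LMerge x y) (LMerge x' y')
| der_Comm x x' y y' : derivable ax x x' -> derivable ax y y' ->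
    derivable ax (Comm x y) (Comm x' y')
| der_Encap H x x' : derivable ax x x' ->
    derivable ax (Encap H x) (Encap H x')
| der_Op o (x x' : 'I_(arity o) -> term A X) :
    (forall k, derivable ax (x k) (x' k)) -> derivable ax (Op o x) (Op o x').

(* Parametric in [X]: the axioms of ACP are also axioms of its extensions, where
   the variables range over the terms of the extended signature. *)
Inductive acp_axiom A X (gamma : option A -> option A -> option A) :
  term A X -> term A X -> Prop :=
| A1 x y : acp_axiom gamma (x + y) (y + x)
| A2 x y z : acp_axiom gamma ((x + y) + z) (x + (y + z))
| A3 x : acp_axiom gamma (x + x) x
| A4 x y z : acp_axiom gamma ((x + y) * z) (x * z + y * z)
| A5 x y z : acp_axiom gamma ((x * y) * z) (x * (y * z))
| A6 x : acp_axiom gamma (x + delta) x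
| A7 x : acp_axiom gamma (delta * x) delta
| D1 (H : A -> Prop) a : ~ oapp H False a ->
    acp_axiom gamma (Encap H (Const a)) (Const a)
| D2 (H : A -> Prop) a : oapp H False a ->
    acp_axiom gamma (Encap H (Const a)) delta
| D3 H x y : acp_axiom gamma (Encap H (x + y)) (Encap H x + Encap H y)
| D4 H x y : acp_axiom gamma (Encap H (x * y)) (Encap H x * Encap H y)
| CM1 x y :
    acp_axiom gamma (Merge x y) ((LMerge x y + LMerge y x) + Comm x y)
| CM2 a x : acp_axiom gamma (LMerge (Const a) x) (Const a * x)
| CM3 a x y : acp_axiom gamma (LMerge (Const a * x) y) (Const a * Merge x y)
| CM4 x y z : acp_axiom gamma (LMerge (x + y) z) (LMerge x z + LMerge y z)
| CM5 a b x :
    acp_axiom gamma (Comm (Const a * x) (Const b)) (Const (gamma a b) * x)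
| CM6 a b x :
    acp_axiom gamma (Comm (Const a) (Const b * x)) (Const (gamma a b) * x)
| CM7 a b x y :
    acp_axiom gamma (Comm (Const a * x) (Const b * y))
                    (Const (gamma a b) * Merge x y)
| CM8 x y z : acp_axiom gamma (Comm (x + y) z) (Comm x z + Comm y z)
| CM9 x y z : acp_axiom gamma (Comm x (y + z)) (Comm x y + Comm x z)
| CM10 x : acp_axiom gamma (Comm delta x) delta
| CM11 x : acp_axiom gamma (Comm x delta) delta
| CM12 a b :
    acp_axiom gamma (Comm (Const a) (Const b)) (Const (gamma a b)).

Definition acp_derivable A (gamma : option A -> option A -> option A) :
  acp_term A -> acp_term A -> Prop :=
  derivable (@acp_axiom A acp_signature gamma).

Inductive is_history : seq (nat * nat) -> Prop :=
| history_nil : is_history [::]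
| history_one i n : 0 < i -> 0 < n -> i <= n -> is_history [:: (i, n)]
| history_step h i n j m :
    is_history (rcons h (i, n)) -> 0 < j -> 0 < m -> j <= n ->
    n.-1 <= m <= n.+1 -> is_history (rcons (rcons h (i, n)) (j, m)).

Definition history := {h : seq (nat * nat) | is_history h}.

(* Positive numbers are shifted: the index [n] below stands for n+1, and
   [i : 'I_n.+1] stands for the element i+1 of {1, ..., n+1}. Only the entries
   of histories are not shifted. *)
Inductive strategic_op (S : Type) : Type :=
| StrOp (n : nat) (h : history) (s : S)
| PosOp (n : nat) (i : 'I_n.+1) (h : history) (s : S).

Definition strategic_arity S (o : strategic_op S) : nat :=
  match o with StrOp n _ _ => n.+1 | PosOp n _ _ _ => n.+1 end.

Definition siacp_signature S := Signature (@strategic_arity S).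
Definition siacp_term A S := term A (siacp_signature S).

Definition Str A S n h s (x : 'I_n.+1 -> siacp_term A S) : siacp_term A S :=
  @Op A (siacp_signature S) (StrOp n h s) x.

Definition Pos A S n (i : 'I_n.+1) h s (x : 'I_n.+1 -> siacp_term A S) :
  siacp_term A S :=
  @Op A (siacp_signature S) (PosOp i h s) x.

Definition put T n (x : 'I_n -> T) (i : 'I_n) (u : T) : 'I_n -> T :=
  fun k => if k == i then u else x k.

Definition remove T n (x : 'I_n.+1 -> T) (i : 'I_n.+1) : 'I_n -> T :=
  fun k => x (lift i k).

Definition append T n (x : 'I_n -> T) (u : T) : 'I_n.+1 -> T :=
  fun k => oapp x u (unlift ord_max k).

Definition extends (h' h : history) (i n : nat) : Prop :=
  sval h' = rcons (sval h) (i, n).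

Definition plain A D (pcr rcr : D -> A) (a : A) : Prop :=
  forall d, a <> pcr d /\ a <> rcr d.

(* In SI4-SI7 the extended history [h'] has to be a history again, since the
   right-hand side is not a term otherwise. *)
Inductive siacp_axiom A S D (gamma : option A -> option A -> option A)
    (sched : forall n, history -> S -> 'I_n.+1)
    (upd : forall n, history -> S -> 'I_n.+1 -> A -> S)
    (cr : D -> siacp_term A S) (pcr rcr : D -> A) :
  siacp_term A S -> siacp_term A S -> Prop :=
| SI_acp x y : acp_axiom gamma x y ->
    siacp_axiom gamma sched upd cr pcr rcr x y
| SI1 n h s (x : 'I_n.+1 -> siacp_term A S) :
    siacp_axiom gamma sched upd cr pcr rcr
      (Str h s x) (Pos (sched n h s) h s x)
| SI2 n (i : 'I_n.+1) h s (x : 'I_n.+1 -> siacp_term A S) :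
    siacp_axiom gamma sched upd cr pcr rcr
      (Pos i h s (put x i delta)) delta
| SI3 (i : 'I_1) h s a : plain pcr rcr a ->
    siacp_axiom gamma sched upd cr pcr rcr
      (Pos i h s (fun=> Act a)) (Act a)
| SI4 n (i : 'I_n.+2) h h' s a (x : 'I_n.+2 -> siacp_term A S) :
    plain pcr rcr a -> extends h' h i.+1 n.+1 ->
    siacp_axiom gamma sched upd cr pcr rcr
      (Pos i h s (put x i (Act a)))
      (Act a * Str h' (upd n.+1 h s i a) (remove x i))
| SI5 n (i : 'I_n.+1) h h' s a u (x : 'I_n.+1 -> siacp_term A S) :
    plain pcr rcr a -> extends h' h i.+1 n.+1 ->
    siacp_axiom gamma sched upd cr pcr rcr
      (Pos i h s (put x i (Act a * u)))
      (Act a * Str h' (upd n h s i a) (put x i u))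
| SI6 n (i : 'I_n.+1) h h' s d (x : 'I_n.+1 -> siacp_term A S) :
    extends h' h i.+1 n.+1 ->
    siacp_axiom gamma sched upd cr pcr rcr
      (Pos i h s (put x i (Act (pcr d))))
      (Act (rcr d) *
         Str h' (upd n h s i (pcr d)) (append (remove x i) (cr d)))
| SI7 n (i : 'I_n.+1) h h' s d u (x : 'I_n.+1 -> siacp_term A S) :
    extends h' h i.+1 n.+2 ->
    siacp_axiom gamma sched upd cr pcr rcr
      (Pos i h s (put x i (Act (pcr d) * u)))
      (Act (rcr d) *
         Str h' (upd n h s i (pcr d)) (append (put x i u) (cr d)))
| SI8 n (i : 'I_n.+1) h s u v (x : 'I_n.+1 -> siacp_term A S) :
    siacp_axiom gamma sched upd cr pcr rcr
      (Pos i h s (put x i (u + v)))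
      (Pos i h s (put x i u) + Pos i h s (put x i v)).

Definition siacp_derivable A S D (gamma : option A -> option A -> option A)
    (sched : forall n, history -> S -> 'I_n.+1)
    (upd : forall n, history -> S -> 'I_n.+1 -> A -> S)
    (cr : D -> siacp_term A S) (pcr rcr : D -> A) :
  siacp_term A S -> siacp_term A S -> Prop :=
  derivable (siacp_axiom gamma sched upd cr pcr rcr).

(* Main.v *)
Require Import Defs.
From mathcomp Require Import all_boot.
From Stdlib Require Import Setoid Morphisms.
From Stdlib Require Import Classical FunctionalExtensionality ProofIrrelevance.

(** The transition relation on terms of siACP yields relations [bisim n],
    bisimilarity up to depth [n], which are congruences satisfying all axioms
    of siACP. On the other hand, every closed ACP term is derivably equal to a
    term built from constants, alternative composition and prefixing by
    constants only, and two such terms of depth at most [n] related by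
    [bisim n] are derivably equal in ACP. Bounding the depth makes coinduction
    superfluous although recursive process creation gives rise to infinite
    behaviour. *)

Set Implicit Arguments.
Unset Strict Implicit.
Unset Printing Implicit Defensive.

Local Open Scope process_scope.

(** * Equational reasoning in ACP *)

Section Derivability.
Variables (A : Type) (X : signature) (ax : term A X -> term A X -> Prop).

#[export] Instance derivable_equivalence : Equivalence (derivable ax).
Proof.
split; [exact: der_refl | exact: der_sym | exact: der_trans].
Qed.

#[export] Instance Alt_derivable :
  Proper (derivable ax ==> derivable ax ==> derivable ax) (@Alt A X).
Proof. by move=> x x' xx' y y' yy'; apply: der_Alt. Qed.

#[export] Instance Seq_derivable :
  Proper (derivable ax ==> derivable ax ==> derivable ax) (@Seq A X).
Proof. by move=> x x' xx' y y' yy'; apply: der_Seq. Qed.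

End Derivability.

(** * Elimination of closed ACP terms in favour of basic terms *)

Section BasicTerms.
Variables (A : Type) (gamma : option A -> option A -> option A).

Local Notation "x == y" := (acp_derivable gamma x y) : process_scope.

(** The constant [c] may be delta, also in a prefix: encapsulation and [gamma] can turn an action
    into delta, and their results then remain basic without a case distinction. *)
Inductive basic : acp_term A -> Prop :=
| basic_const c : basic (Const c)
| basic_prefix c x : basic x -> basic (Const c * x)
| basic_alt x y : basic x -> basic y -> basic (x + y).

(* Only meaningful on basic terms. *)
Fixpoint depth (t : acp_term A) : nat :=
  match t with
  | Alt x y => maxn (depth x) (depth y)
  | Seq _ y => (depth y).+1
  | _ => 1
  end.

Definition reducible (t : acp_term A) := exists2 b, basic b & t == b.

Lemma basic_reducible b : basic b -> reducible b.
Proof. by move=> hb; exists b => //; apply: der_refl. Qed.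

Lemma reducible_derivable t u : t == u -> reducible u -> reducible t.
Proof. by move=> tu [b hb ub]; exists b => //; apply: der_trans tu ub. Qed.

Lemma reducible_const c : reducible (Const c).
Proof. exact/basic_reducible/basic_const. Qed.

Lemma reducible_prefix c x : reducible x -> reducible (Const c * x).
Proof.
move=> [b hb xb]; exists (Const c * b); first exact: basic_prefix.
by apply: der_Seq xb; apply: der_refl.
Qed.

Lemma reducible_alt x y : reducible x -> reducible y -> reducible (x + y).
Proof.
move=> [b hb xb] [c hc yc]; exists (b + c); first exact: basic_alt.
exact: der_Alt.
Qed.

Lemma reducible_seq x y : basic x -> basic y -> reducible (x * y).
Proof.
move=> hx hy; elim: hx => [c|c x' _ IH|x1 x2 _ IH1 _ IH2].
- exact/basic_reducible/basic_prefix.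
- apply: reducible_derivable (der_ax (A5 gamma _ _ _)) _.
  exact: reducible_prefix.
- apply: reducible_derivable (der_ax (A4 gamma _ _ _)) _.
  exact: reducible_alt.
Qed.

Lemma encap_const (H : A -> Prop) c :
  exists c', Encap H (Const c : acp_term A) == Const c'.
Proof.
by case: (classic (oapp H False c)) => Hc;
  [exists None | exists c]; apply: der_ax; [apply: D2 | apply: D1].
Qed.

Lemma reducible_encap H x : basic x -> reducible (Encap H x).
Proof.
elim=> [c|c x' _ IH|x1 x2 _ IH1 _ IH2].
- have [c' cc'] := encap_const H c.
  exact: reducible_derivable cc' (reducible_const _).
- apply: reducible_derivable (der_ax (D4 gamma _ _ _)) _.
  have [c' cc'] := encap_const H c.
  apply: reducible_derivable (der_Seq cc' (der_refl _ _)) _.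
  exact: reducible_prefix.
- apply: reducible_derivable (der_ax (D3 gamma _ _ _)) _.
  exact: reducible_alt.
Qed.

Section MergeStep.
Variable n : nat.
Hypothesis merge_lt : forall x y, basic x -> basic y ->
  depth x + depth y < n -> reducible (Merge x y).

(** The only merge to be reduced arises from CM3, where the prefix is stripped and the total depth
    drops below [n], so that [merge_lt] applies. *)
Lemma reducible_lmerge_step x y : basic x -> basic y ->
  depth x + depth y <= n -> reducible (LMerge x y).
Proof.
move=> hx hy; elim: hx => /= [c|c x' hx' _|x1 x2 _ IH1 _ IH2] le_n.
- apply: reducible_derivable (der_ax (CM2 gamma _ _)) _.
  exact/basic_reducible/basic_prefix.
- apply: reducible_derivable (der_ax (CM3 gamma _ _ _)) _.
  exact/reducible_prefix/merge_lt.
- apply: reducible_derivable (der_ax (CM4 gamma _ _ _)) _.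
  move: le_n; rewrite addn_maxl geq_max => /andP[le1 le2].
  by apply: reducible_alt; [apply: IH1 | apply: IH2].
Qed.

(** Induction on [x] distributes over its summands by CM8; for a constant or a prefix, a nested
    induction on [y] does the same by CM9. The only merge left comes from CM7, where both depths
    drop. *)
Lemma reducible_comm_step x y : basic x -> basic y ->
  depth x + depth y <= n -> reducible (Comm x y).
Proof.
move=> hx hy; elim: hx => /= [c|c x' hx' _|x1 x2 _ IH1 _ IH2] le_n.
- elim: hy {le_n} => [e|e y' hy' _|y1 y2 _ IH1 _ IH2].
  + apply: reducible_derivable (der_ax (CM12 _ gamma _ _)) _.
    exact: reducible_const.
  + apply: reducible_derivable (der_ax (CM6 gamma _ _ _)) _.
    exact/basic_reducible/basic_prefix.
  + apply: reducible_derivable (der_ax (CM9 gamma _ _ _)) _.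
    exact: reducible_alt.
- elim: hy le_n => /= [e|e y' hy' _|y1 y2 _ IH1 _ IH2] le_n.
  + apply: reducible_derivable (der_ax (CM5 gamma _ _ _)) _.
    exact/basic_reducible/basic_prefix.
  + apply: reducible_derivable (der_ax (CM7 gamma _ _ _ _)) _.
    apply/reducible_prefix/merge_lt => //.
    by apply: leq_trans le_n; rewrite addSn addnS ltnS leqnSn.
  + apply: reducible_derivable (der_ax (CM9 gamma _ _ _)) _.
    move: le_n; rewrite addn_maxr geq_max => /andP[le1 le2].
    by apply: reducible_alt; [apply: IH1 | apply: IH2].
- apply: reducible_derivable (der_ax (CM8 gamma _ _ _)) _.
  move: le_n; rewrite addn_maxl geq_max => /andP[le1 le2].
  by apply: reducible_alt; [apply: IH1 | apply: IH2].
Qed.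

End MergeStep.

(** CM1 yields left and communication merges of the same total depth, and these lead back only to
    merges of smaller total depth; hence the induction on a strict bound of that depth. *)
Lemma reducible_merge x y : basic x -> basic y -> reducible (Merge x y).
Proof.
move: {2}_.+1 (ltnSn (depth x + depth y)) => n.
elim: n x y => // n IH x y le_n hx hy.
have lt_merge x' y' : basic x' -> basic y' ->
    depth x' + depth y' < n -> reducible (Merge x' y').
  by move=> hx' hy' lt_n; apply: IH.
apply: reducible_derivable (der_ax (CM1 gamma _ _)) _.
apply: reducible_alt; first apply: reducible_alt.
- exact: (reducible_lmerge_step lt_merge).
- by apply: (reducible_lmerge_step lt_merge); rewrite 1?addnC.
- exact: (reducible_comm_step lt_merge).
Qed.

Lemma reducible_lmerge x y : basic x -> basic y -> reducible (LMerge x y).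
Proof.
move=> hx hy; apply: reducible_lmerge_step (leqnn _) => // x' y' hx' hy' _.
exact: reducible_merge.
Qed.

Lemma reducible_comm x y : basic x -> basic y -> reducible (Comm x y).
Proof.
move=> hx hy; apply: reducible_comm_step (leqnn _) => // x' y' hx' hy' _.
exact: reducible_merge.
Qed.

Lemma closed_reducible (t : acp_term A) : is_closed t -> reducible t.
Proof.
(* A variable is not closed, and the signature of ACP has no additional operators. *)
elim: t => //= [c _|||||||[]].
- exact: reducible_const.
- by move=> x IHx y IHy [/IHx hx /IHy hy]; apply: reducible_alt.
- move=> x IHx y IHy [/IHx [b hb xb] /IHy [c hc yc]].
  by apply: reducible_derivable (der_Seq xb yc) (reducible_seq hb hc).
- move=> x IHx y IHy [/IHx [b hb xb] /IHy [c hc yc]].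
  by apply: reducible_derivable (der_Merge xb yc) (reducible_merge hb hc).
- move=> x IHx y IHy [/IHx [b hb xb] /IHy [c hc yc]].
  by apply: reducible_derivable (der_LMerge xb yc) (reducible_lmerge hb hc).
- move=> x IHx y IHy [/IHx [b hb xb] /IHy [c hc yc]].
  by apply: reducible_derivable (der_Comm xb yc) (reducible_comm hb hc).
- move=> H x IHx /IHx [b hb xb].
  by apply: reducible_derivable (der_Encap H xb) (reducible_encap H hb).
Qed.

End BasicTerms.

(** * Bisimilarity up to a given depth *)

Section Semantics.
Variables (A S D : Type) (gamma : option A -> option A -> option A).
Hypothesis gamma_comm : forall a b, gamma a b = gamma b a.
Hypothesis gamma_delta : forall a, gamma None a = None.
Variables (sched : forall n : nat, history -> S -> 'I_n.+1)
  (upd : forall n : nat, history -> S -> 'I_n.+1 -> A -> S)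
  (cr : D -> siacp_term A S) (pcr rcr : D -> A).
Hypothesis pcr_inj : injective pcr.

Local Notation sterm := (siacp_term A S).
Local Notation behaviour := (A -> option sterm -> Prop).

(* The outcome of a step is the remaining process, or [None] upon successful
   termination. *)
Definition seq_cont (r : option sterm) (y : sterm) : sterm :=
  if r is Some x then x * y else y.

Definition merge_cont (r : option sterm) (y : sterm) : sterm :=
  if r is Some x then Merge x y else y.

Definition comm_cont (r r' : option sterm) : option sterm :=
  if r' is Some y then Some (merge_cont r y) else r.

(** The two cases mirror SI3 and SI4. Since indices are shifted, [m.+1] stands for m+2 operands, of
    which m+1 remain, and this is the number recorded in the history. *)
Definition exit_step n : 'I_n.+1 -> history -> S ->
    ('I_n.+1 -> sterm) -> behaviour :=
  match n with
  | 0 => fun i h s x a r => r = None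
  | m.+1 => fun i h s x a r => exists2 h', extends h' h i.+1 m.+1 &
      r = Some (Str h' (upd h s i a) (remove x i))
  end.

(* No axiom applies to an operand that starts with an action [rcr d] not of the
   form [pcr d'], or to a history that cannot be extended: these are blocked. *)
Inductive pos_step n (i : 'I_n.+1) h s (x : 'I_n.+1 -> sterm)
    (step_i : behaviour) : behaviour :=
| pos_exit a r : step_i a None -> plain pcr rcr a ->
    exit_step i h s x a r -> pos_step i h s x step_i a r
| pos_continue a u h' : step_i a (Some u) -> plain pcr rcr a ->
    extends h' h i.+1 n.+1 ->
    pos_step i h s x step_i a (Some (Str h' (upd h s i a) (put x i u)))
| pos_create_exit d h' : step_i (pcr d) None -> extends h' h i.+1 n.+1 ->
    pos_step i h s x step_i (rcr d)
      (Some (Str h' (upd h s i (pcr d)) (append (remove x i) (cr d))))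
| pos_create_continue d u h' : step_i (pcr d) (Some u) ->
    extends h' h i.+1 n.+2 ->
    pos_step i h s x step_i (rcr d)
      (Some (Str h' (upd h s i (pcr d)) (append (put x i u) (cr d)))).

(** Taking the steps of the operands as an argument keeps the recursion in [step] structural. SI1 is
    built in: both operators step through [pos_step]. *)
Definition op_step (o : strategic_op S) : ('I_(strategic_arity o) -> sterm) ->
    ('I_(strategic_arity o) -> behaviour) -> behaviour :=
  match o with
  | StrOp n h s => fun x steps =>
      pos_step (sched n h s) h s x (steps (sched n h s))
  | PosOp n i h s => fun x steps => pos_step i h s x (steps i)
  end.

Definition lmerge_step (step_x : behaviour) (y : sterm) : behaviour :=
  fun a r => exists2 r', step_x a r' & r = Some (merge_cont r' y).

Definition comm_step (step_x step_y : behaviour) : behaviour :=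
  fun a r => exists b r1 c r2, [/\ step_x b r1, step_y c r2,
    gamma (Some b) (Some c) = Some a & r = comm_cont r1 r2].

Fixpoint step (t : sterm) : behaviour :=
  match t with
  | Var _ => fun _ _ => False
  | Const c => fun a r => c = Some a /\ r = None
  | Alt x y => fun a r => step x a r \/ step y a r
  | Seq x y => fun a r => exists2 r', step x a r' & r = Some (seq_cont r' y)
  | Merge x y => fun a r =>
      (lmerge_step (step x) y a r \/ lmerge_step (step y) x a r) \/
      comm_step (step x) (step y) a r
  | LMerge x y => lmerge_step (step x) y
  | Comm x y => comm_step (step x) (step y)
  | Encap H x => fun a r =>
      exists2 r', step x a r' & ~ H a /\ r = omap (Encap H) r'
  | Op o x => @op_step o x (fun k => step (x k))
  end.

Definition opt_rel (R : sterm -> sterm -> Prop) (r r' : option sterm) : Prop :=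
  match r, r' with
  | None, None => True
  | Some x, Some y => R x y
  | _, _ => False
  end.

Definition simulates (R : sterm -> sterm -> Prop) (p q : behaviour) : Prop :=
  forall a r, p a r -> exists2 r', q a r' & opt_rel R r r'.

Fixpoint bisim (n : nat) (x y : sterm) : Prop :=
  if n is m.+1 then
    simulates (bisim m) (step x) (step y) /\
    simulates (bisim m) (step y) (step x)
  else True.

(** * Bounded bisimilarity as a decreasing chain of equivalences *)

Lemma bisim_refl n x : bisim n x x.
Proof.
elim: n x => //= n IH x.
by split=> a r xr; exists r => //; case: r {xr} => /=.
Qed.

Lemma bisim_sym n x y : bisim n x y -> bisim n y x.
Proof. by case: n => //= n []. Qed.

Lemma opt_rel_refl n r : opt_rel (bisim n) r r.
Proof. by case: r => //= x; apply: bisim_refl. Qed.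

Lemma opt_rel_trans R : (forall x y z, R x y -> R y z -> R x z) ->
  forall r1 r2 r3, opt_rel R r1 r2 -> opt_rel R r2 r3 -> opt_rel R r1 r3.
Proof. by move=> tr [x|] [y|] [z|] //=; apply: tr. Qed.

Lemma bisim_trans n x y z : bisim n x y -> bisim n y z -> bisim n x z.
Proof.
elim: n x y z => //= n IH x y z [xy yx] [yz zy]; split=> a r.
- move=> /xy [r' /yz [r'' zr'' rr''] rr']; exists r'' => //.
  exact: (opt_rel_trans IH) rr' rr''.
- move=> /zy [r' /yx [r'' zr'' rr''] rr']; exists r'' => //.
  exact: (opt_rel_trans IH) rr' rr''.
Qed.

(** Used for operands that do not move in a step: they are related at depth [n.+1], while the
    remaining processes are compared at depth [n]. *)
Lemma bisimW n x y : bisim n.+1 x y -> bisim n x y.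
Proof.
elim: n x y => // n IH x y [xy yx].
by split=> a r; [move=> /xy [r' yr'] | move=> /yx [r' yr']] => rr';
  exists r' => //; case: r r' rr' {yr'} => [u|] [v|] //=; apply: IH.
Qed.

(** This settles all axioms except A5 and D4, whose two sides reach different terms. *)
Lemma bisim_step_eq n x y : (forall a r, step x a r <-> step y a r) ->
  bisim n x y.
Proof.
case: n => //= n xy; split=> a r /xy xr; exists r => //; exact: opt_rel_refl.
Qed.

(** * Congruence of bounded bisimilarity *)

Lemma bisim_alt n x x' y y' : bisim n x x' -> bisim n y y' ->
  bisim n (x + y) (x' + y').
Proof.
case: n => //= n [xx' x'x] [yy' y'y].
by split=> a r; [case=> [/xx'|/yy'] | case=> [/x'x|/y'y]] => -[r' ? ?];
  exists r' => //=; tauto.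
Qed.

Lemma bisim_cong2 (f : sterm -> sterm -> sterm) n :
  (forall x x' y y', bisim n.+1 x x' -> bisim n.+1 y y' ->
     simulates (bisim n) (step (f x y)) (step (f x' y'))) ->
  forall x x' y y', bisim n.+1 x x' -> bisim n.+1 y y' ->
    bisim n.+1 (f x y) (f x' y').
Proof.
move=> half x x' y y' xx' yy'.
by split; apply: half => //; apply: bisim_sym.
Qed.

Lemma bisim_seq n x x' y y' : bisim n x x' -> bisim n y y' ->
  bisim n (x * y) (x' * y').
Proof.
elim: n x x' y y' => // n IH.
apply: bisim_cong2 => x x' y y' [xx' _] yy' a r [r1 /xx' [r2 xr2 r12] ->].
exists (Some (seq_cont r2 y')); first by exists r2.
by case: r1 r2 r12 {xr2} => [u|] [v|] //= uv;
  [apply: IH => // |]; apply: bisimW.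
Qed.

Lemma bisim_encap n H x x' : bisim n x x' ->
  bisim n (Encap H x) (Encap H x').
Proof.
elim: n x x' => // n IH.
suff half x x' : bisim n.+1 x x' ->
    simulates (bisim n) (step (Encap H x)) (step (Encap H x')).
  by move=> x x' xx'; split; apply: half => //; apply: bisim_sym.
move=> [xx' _] a r [r1 /xx' [r2 xr2 r12] [Ha ->]].
exists (omap (Encap H) r2); first by exists r2.
by case: r1 r2 r12 {xr2} => [u|] [v|] //=; apply: IH.
Qed.

Lemma merge_cont_cong n r r' y y' :
  (forall x x' z z', bisim n x x' -> bisim n z z' ->
     bisim n (Merge x z) (Merge x' z')) ->
  opt_rel (bisim n) r r' -> bisim n y y' ->
  bisim n (merge_cont r y) (merge_cont r' y').
Proof. by move=> cong; case: r r' => [u|] [v|] //=; apply: cong. Qed.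

(** The three operators are treated together because, as long as both operands survive, a step of
    any of them leads to a merge; the induction hypothesis is applied to merges only. *)
Lemma bisim_par n x x' y y' : bisim n x x' -> bisim n y y' ->
  [/\ bisim n (Merge x y) (Merge x' y'),
      bisim n (LMerge x y) (LMerge x' y') &
      bisim n (Comm x y) (Comm x' y')].
Proof.
elim: n x x' y y' => // n IH.
have cong u u' v v' : bisim n u u' -> bisim n v v' ->
    bisim n (Merge u v) (Merge u' v').
  by move=> uu' vv'; have [] := IH _ _ _ _ uu' vv'.
have lhalf u u' v v' : bisim n.+1 u u' -> bisim n.+1 v v' ->
    simulates (bisim n) (lmerge_step (step u) v) (lmerge_step (step u') v').
  move=> [uu' _] /bisimW vv' a r [r1 /uu' [r2 ur2 r12] ->].
  exists (Some (merge_cont r2 v')); first by exists r2.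
  exact: merge_cont_cong.
have chalf u u' v v' : bisim n.+1 u u' -> bisim n.+1 v v' ->
    simulates (bisim n) (comm_step (step u) (step v))
                        (comm_step (step u') (step v')).
  move=> [uu' _] [vv' _] a r [b [r1 [c [r2 [/uu' [r1' ur1' r11']]]]]].
  move=> /vv' [r2' vr2' r22'] bc ->.
  exists (comm_cont r1' r2'); first by exists b, r1', c, r2'.
  case: r2 r2' r22' {vr2'} => [w|] [w'|] //= ww'.
  exact: merge_cont_cong.
move=> x x' y y' xx' yy'; split.
- move: x x' y y' xx' yy'; apply: bisim_cong2 => x x' y y' xx' yy' a r.
  by case=> [[]|] /=; [move/(lhalf _ _ _ _ xx' yy')
    |move/(lhalf _ _ _ _ yy' xx')|move/(chalf _ _ _ _ xx' yy')];
    move=> [r' st rr']; exists r' => //; tauto.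
- by move: x x' y y' xx' yy'; apply: bisim_cong2.
- by move: x x' y y' xx' yy'; apply: bisim_cong2.
Qed.

Lemma put_cong m n (x x' : 'I_n -> sterm) i u u' :
  (forall k, bisim m (x k) (x' k)) -> bisim m u u' ->
  forall k, bisim m (put x i u k) (put x' i u' k).
Proof. by move=> xx' uu' k; rewrite /put; case: eqP. Qed.

Lemma append_cong m n (x x' : 'I_n -> sterm) u :
  (forall k, bisim m (x k) (x' k)) ->
  forall k, bisim m (append x u k) (append x' u k).
Proof.
move=> xx' k; rewrite /append; case: unliftP => [j _|_] //=.
exact: bisim_refl.
Qed.

(** The scheduled position, the next history and the next control state depend on the action
    performed but not on the operands, so matching steps lead to the same operator. A created
    process [cr d] is the same on both sides; as the induction is on the depth, recursive creation
    does no harm. *)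
Lemma bisim_op n (o : strategic_op S) (x x' : 'I_(strategic_arity o) -> sterm) :
  (forall k, bisim n (x k) (x' k)) ->
  bisim n (@Op A (siacp_signature S) o x) (@Op A (siacp_signature S) o x').
Proof.
elim: n o x x' => // n IH.
have half m (i : 'I_m.+1) h s (x x' : 'I_m.+1 -> sterm) :
    (forall k, bisim n.+1 (x k) (x' k)) ->
    simulates (bisim n) (pos_step i h s x (step (x i)))
                        (pos_step i h s x' (step (x' i))).
  move=> xx'; have [xxi _] := xx' i.
  have {}xx' k : bisim n (x k) (x' k) by apply: bisimW.
  have str l h' s' (y y' : 'I_l.+1 -> sterm) :
      (forall k, bisim n (y k) (y' k)) -> bisim n (Str h' s' y) (Str h' s' y').
    by move=> yy'; apply: (IH (StrOp l h' s')).
  move=> a r; case=> {a r}.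
  - move=> a r /xxi [[//|] xa _] pa er.
    have [r' er' rr'] : exists2 r', exit_step i h s x' a r' &
        opt_rel (bisim n) r r'.
      case: m i x x' xx' {xxi xa} er => [|m] i x x' xx' /=.
        by move=> ->; exists None.
      move=> [h' ext ->]; exists (Some (Str h' (upd h s i a) (remove x' i))).
        by exists h'.
      by apply: str => k; apply: xx'.
    by exists r' => //; apply: pos_exit.
  - move=> a u h' /xxi [[u'|//] xa uu'] pa ext.
    exists (Some (Str h' (upd h s i a) (put x' i u'))).
      exact: pos_continue.
    by apply: str; apply: put_cong.
  - move=> d h' /xxi [[//|] xa _] ext.
    exists (Some (Str h' (upd h s i (pcr d)) (append (remove x' i) (cr d)))).
      exact: pos_create_exit.
    by apply: str; apply: append_cong => k; apply: xx'.
  - move=> d u h' /xxi [[u'|//] xa uu'] ext.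
    exists (Some (Str h' (upd h s i (pcr d)) (append (put x' i u') (cr d)))).
      exact: pos_create_continue.
    by apply: str; apply: append_cong; apply: put_cong.
move=> [m h s|m i h s] /= x x' xx'.
  by split; apply: half => // k; apply: bisim_sym.
by split; apply: half => // k; apply: bisim_sym.
Qed.

(** * Soundness of the axioms of ACP *)

Lemma gamma_deltar a : gamma a None = None.
Proof. by rewrite gamma_comm. Qed.

(** After a step of [x] the remaining processes form another instance of the law, or coincide if [x]
    has terminated. *)
Lemma bisim_seqA n x y z : bisim n ((x * y) * z) (x * (y * z)).
Proof.
elim: n x y z => //= n IH x y z; split=> a r.
- move=> [_ [r1 xr ->] ->]; exists (Some (seq_cont r1 (y * z))).
    by exists r1.
  by case: r1 {xr} => [u|] /=; [apply: IH | apply: bisim_refl].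
- move=> [r1 xr ->]; exists (Some (seq_cont r1 y * z)).
    by exists (Some (seq_cont r1 y)) => //; exists r1.
  by case: r1 {xr} => [u|] /=; [apply/bisim_sym/IH | apply: bisim_refl].
Qed.

Lemma bisim_encap_seq n H x y :
  bisim n (Encap H (x * y)) (Encap H x * Encap H y).
Proof.
elim: n x y => //= n IH x y; split=> a r.
- move=> [_ [r1 xr ->] [Ha ->]].
  exists (Some (seq_cont (omap (Encap H) r1) (Encap H y))).
    by exists (omap (Encap H) r1) => //; exists r1.
  by case: r1 {xr} => [u|] /=; [apply: IH | apply: bisim_refl].
- move=> [_ [r1 xr [Ha ->]] ->]; exists (Some (Encap H (seq_cont r1 y))).
    by exists (Some (seq_cont r1 y)) => //; exists r1.
  by case: r1 {xr} => [u|] /=; [apply/bisim_sym/IH | apply: bisim_refl].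
Qed.

Lemma step_prefix c x a r :
  step (Const c * x) a r <-> c = Some a /\ r = Some x.
Proof.
split=> /= [[_ [-> ->] ->] //|[-> ->]].
by exists None.
Qed.

Lemma bisim_acp_axiom n (x y : sterm) : acp_axiom gamma x y -> bisim n x y.
Proof.
case=> {x y}.
- by move=> x y; apply: bisim_step_eq => a r /=; tauto.
- by move=> x y z; apply: bisim_step_eq => a r /=; tauto.
- by move=> x; apply: bisim_step_eq => a r /=; tauto.
- move=> x y z; apply: bisim_step_eq => a r /=; split.
    by case=> r' [] xr ->; [left|right]; exists r'.
  by case=> -[r' xr ->]; exists r'; tauto.
- exact: bisim_seqA.
- move=> x; apply: bisim_step_eq => a r /=; split; last by left.
  by case=> // -[].
- by move=> x; apply: bisim_step_eq => a r; rewrite step_prefix; split=> -[].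
- move=> H a Ha; apply: bisim_step_eq => b r /=; split.
    by case=> _ [-> ->] [_ ->].
  by case=> ab ->; exists None => //; split=> //; move: Ha; rewrite ab.
- move=> H a Ha; apply: bisim_step_eq => b r /=; split; last by case.
  by case=> r1 [ab _] [Hb _]; move: Ha; rewrite ab.
- move=> H x y; apply: bisim_step_eq => a r /=; split.
    by case=> r' [] xr [Ha ->]; [left|right]; exists r'.
  by case=> -[r' xr [Ha ->]]; exists r'; tauto.
- exact: bisim_encap_seq.
- by move=> x y; apply: bisim_step_eq => a r /=; tauto.
- move=> a x; apply: bisim_step_eq => b r; rewrite step_prefix; split.
    by case=> _ [-> ->] ->.
  by case=> -> ->; exists None.
- move=> a x y; apply: bisim_step_eq => b r; rewrite step_prefix; split.
    by case=> _ /step_prefix [-> ->] ->.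
  by case=> -> ->; exists (Some x) => //; apply/step_prefix.
- move=> x y z; apply: bisim_step_eq => a r /=; split.
    by case=> r' [] xr ->; [left|right]; exists r'.
  by case=> -[r' xr ->]; exists r' => //=; tauto.
- move=> a b x; apply: bisim_step_eq => e r; rewrite step_prefix; split.
    by case=> a' [_ [b' [_ [/step_prefix [-> ->] [-> ->] -> ->]]]].
  (* A step labelled by the value of [gamma] forces both of its arguments to be actions, because
     delta is absorbing. *)
  case: a => [a|]; last by rewrite gamma_delta => -[].
  case: b => [b|]; last by rewrite gamma_deltar => -[].
  by case=> ab ->; exists a, (Some x), b, None; split=> //; apply/step_prefix.
- move=> a b x; apply: bisim_step_eq => e r; rewrite step_prefix; split.
    by case=> a' [_ [b' [_ [[-> ->] /step_prefix [-> ->] -> ->]]]].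
  case: a => [a|]; last by rewrite gamma_delta => -[].
  case: b => [b|]; last by rewrite gamma_deltar => -[].
  by case=> ab ->; exists a, None, b, (Some x); split=> //; apply/step_prefix.
- move=> a b x y; apply: bisim_step_eq => e r; rewrite step_prefix; split.
    by case=> a' [_ [b' [_ [/step_prefix [-> ->] /step_prefix [-> ->] -> ->]]]].
  case: a => [a|]; last by rewrite gamma_delta => -[].
  case: b => [b|]; last by rewrite gamma_deltar => -[].
  by case=> ab ->; exists a, (Some x), b, (Some y);
    split=> //; apply/step_prefix.
- move=> x y z; apply: bisim_step_eq => a r /=; split.
    by case=> b [r1 [c [r2 [[] xr yr bc ->]]]]; [left|right];
      exists b, r1, c, r2.
  by case=> -[b [r1 [c [r2 [xr yr bc ->]]]]]; exists b, r1, c, r2;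
    split=> //=; tauto.
- move=> x y z; apply: bisim_step_eq => a r /=; split.
    by case=> b [r1 [c [r2 [xr [] yr bc ->]]]]; [left|right];
      exists b, r1, c, r2.
  by case=> -[b [r1 [c [r2 [xr yr bc ->]]]]]; exists b, r1, c, r2;
    split=> //=; tauto.
- move=> x; apply: bisim_step_eq => a r /=; split; last by case.
  by case=> b [r1 [c [r2 [[]]]]].
- move=> x; apply: bisim_step_eq => a r /=; split; last by case.
  by case=> b [r1 [c [r2 [_ []]]]].
- move=> a b; apply: bisim_step_eq => e r /=; split.
    by case=> a' [_ [b' [_ [[-> ->] [-> ->] -> ->]]]].
  case: a => [a|]; last by rewrite gamma_delta => -[].
  case: b => [b|]; last by rewrite gamma_deltar => -[].
  by case=> ab ->; exists a, None, b, None.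
Qed.

(** * Soundness of the axioms of strategic interleaving *)

(** Identifies the history chosen in a step with the one in the axiom; the proofs that they are
    histories agree by proof irrelevance. *)
Lemma extends_inj h1 h2 h i n : extends h1 h i n -> extends h2 h i n -> h1 = h2.
Proof.
rewrite /extends => <-; case: h1 h2 => [h1 p1] [h2 p2] /= e; subst h2.
by rewrite (proof_irrelevance _ p1 p2).
Qed.

Lemma put_id T n (x : 'I_n -> T) i u : put x i u i = u.
Proof. by rewrite /put eqxx. Qed.

Lemma put_put T n (x : 'I_n -> T) i u v : put (put x i u) i v = put x i v.
Proof.
by apply: functional_extensionality => k; rewrite /put; case: eqP.
Qed.

Lemma remove_put T n (x : 'I_n.+1 -> T) i u : remove (put x i u) i = remove x i.
Proof.
apply: functional_extensionality => k.
by rewrite /remove /put eq_sym (negbTE (neq_lift i k)).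
Qed.

(** Operand [i] matters only through its steps [p], since every outcome overwrites or removes it. *)
Lemma pos_step_put n (i : 'I_n.+1) h s x w (p : behaviour) a r :
  pos_step i h s (put x i w) p a r <-> pos_step i h s x p a r.
Proof.
have er b : exit_step i h s (put x i w) b = exit_step i h s x b.
  by case: n i x {p} => //= n i x; rewrite remove_put.
split; case=> {a r}.
- by move=> a r pa pl; rewrite er; apply: pos_exit.
- by move=> a u h' pa pl ext; rewrite put_put; apply: pos_continue.
- by move=> d h' pa ext; rewrite remove_put; apply: pos_create_exit.
- by move=> d u h' pa ext; rewrite put_put; apply: pos_create_continue.
- by move=> a r pa pl; rewrite -er; apply: pos_exit.
- move=> a u h' pa pl ext; rewrite -(put_put x i w u).
  exact: pos_continue.
- move=> d h' pa ext; rewrite -(remove_put x i w).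
  exact: pos_create_exit.
- move=> d u h' pa ext; rewrite -(put_put x i w u).
  exact: pos_create_continue.
Qed.

Lemma step_pos_put n (i : 'I_n.+1) h s (x : 'I_n.+1 -> sterm) w a r :
  step (Pos i h s (put x i w)) a r <-> pos_step i h s x (step w) a r.
Proof. by rewrite /= pos_step_put put_id. Qed.

Lemma bisim_siacp_axiom n (x y : sterm) :
  siacp_axiom gamma sched upd cr pcr rcr x y -> bisim n x y.
Proof.
case=> {x y} [x y|m h s x|m i h s x|i h s a pl|m i h h' s a x pl ext
  |m i h h' s a u x pl ext|m i h h' s d x ext|m i h h' s d u x ext
  |m i h s u v x].
- exact: bisim_acp_axiom.
- by apply: bisim_step_eq.
- apply: bisim_step_eq => a r; rewrite step_pos_put.
  by split=> [[? ? []|? ? ? []|? ? []|? ? ? []]|[]].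
- apply: bisim_step_eq => b r /=; split.
    by case=> {b r} [b r [[->] _] _ -> //|b u h' []
      |d h' [[ad] _]|d u h' []] //; have [] := pl d.
  by case=> -[<-] ->; apply: pos_exit.
- apply: bisim_step_eq => b r; rewrite step_pos_put step_prefix; split.
    case=> {b r} [b r [[->] _] _ [h'' ext'' ->]|b u h'' []
      |d h'' [[ad] _]|d u h'' []] //; last by have [] := pl d.
    by rewrite (extends_inj ext'' ext).
  by case=> -[<-] ->; apply: pos_exit => //; exists h'.
- apply: bisim_step_eq => b r; rewrite step_pos_put step_prefix; split.
    case=> {b r} [b r /step_prefix [] //
      |b w h'' /step_prefix [[->] [->]] _ ext''
      |d h'' /step_prefix [] //|d w h'' /step_prefix [[ad] _]];
      last by have [] := pl d.
    by rewrite (extends_inj ext'' ext).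
  by case=> -[<-] ->; apply: pos_continue => //; apply/step_prefix.
(* The action [pcr d] is not plain, so only process creation is possible, and injectivity of [pcr]
   determines the created datum. *)
- apply: bisim_step_eq => b r; rewrite step_pos_put step_prefix; split.
    case=> {b r} [b r [[<-] _] /(_ d) [] //|b w h'' []
      |d' h'' [[/pcr_inj <-] _] ext''|d' w h'' []] //.
    by rewrite (extends_inj ext'' ext).
  by case=> -[<-] ->; apply: pos_create_exit.
- apply: bisim_step_eq => b r; rewrite step_pos_put step_prefix; split.
    case=> {b r} [b r /step_prefix [] //
      |b w h'' /step_prefix [[<-] _] /(_ d) [] //|d' h'' /step_prefix [] //
      |d' w h'' /step_prefix [[/pcr_inj <-] [->]] ext''].
    by rewrite (extends_inj ext'' ext).
  by case=> -[<-] ->; apply: pos_create_continue => //; apply/step_prefix.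
- apply: bisim_step_eq => a r /=; rewrite !pos_step_put !put_id /=; split.
    by case=> {a r} [a r []|a w h' []|d h' []|d w h' []] st *;
      [left|right|left|right|left|right|left|right];
      by [exact: pos_exit|exact: pos_continue
         |exact: pos_create_exit|exact: pos_create_continue].
  by case; case=> {a r} [a r|a w h'|d h'|d w h'] st *;
    [apply: pos_exit|apply: pos_continue
    |apply: pos_create_exit|apply: pos_create_continue
    |apply: pos_exit|apply: pos_continue
    |apply: pos_create_exit|apply: pos_create_continue] => //; tauto.
Qed.

Lemma siacp_derivable_bisim n x y :
  siacp_derivable gamma sched upd cr pcr rcr x y -> bisim n x y.
Proof.
elim=> {x y}.
- by move=> x y; apply: bisim_siacp_axiom.
- by move=> x; apply: bisim_refl.
- by move=> x y _; apply: bisim_sym.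
- by move=> x y z _ xy _; apply: bisim_trans.
- by move=> x x' y y' _ xx' _; apply: bisim_alt.
- by move=> x x' y y' _ xx' _; apply: bisim_seq.
- by move=> x x' y y' _ xx' _ yy'; have [] := bisim_par xx' yy'.
- by move=> x x' y y' _ xx' _ yy'; have [] := bisim_par xx' yy'.
- by move=> x x' y y' _ xx' _ yy'; have [] := bisim_par xx' yy'.
- by move=> H x x' _; apply: bisim_encap.
- by move=> o x x' _; apply: bisim_op.
Qed.

(** * Conservativity *)

Local Notation emb := (embed (siacp_signature S)).
Local Notation "x == y" := (acp_derivable gamma x y) : process_scope.

Lemma embed_acp_axiom (x y : acp_term A) :
  acp_axiom gamma x y -> acp_axiom gamma (emb x) (emb y).
Proof. by case=> * /=; constructor. Qed.

Lemma embed_derivable (x y : acp_term A) : x == y ->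
  siacp_derivable gamma sched upd cr pcr rcr (emb x) (emb y).
Proof.
elim=> {x y} /=; try by move=> *; econstructor; eauto.
by move=> x y xy; apply/der_ax/SI_acp/embed_acp_axiom.
Qed.

Definition summand (a : A) (r : option (acp_term A)) : acp_term A :=
  if r is Some x then Act a * x else Act a.

(** A step of a basic term comes from one of its summands, which idempotence allows to be
    duplicated. The decrease in depth supports the later induction. *)
Lemma basic_step (b : acp_term A) a r : basic b -> step (emb b) a r ->
  exists r', [/\ r = omap emb r', b == b + summand a r' &
    forall x, r' = Some x -> basic x /\ depth x < depth b].
Proof.
move=> hb; elim: hb => [c|c x hx _|x y hx IHx hy IHy].
- move=> [-> ->]; exists None; split=> //.
  exact/der_sym/der_ax/A3.
- move=> /step_prefix [-> ->]; exists (Some x); split=> //.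
    exact/der_sym/der_ax/A3.
  by move=> _ [<-].
- move=> /= [/IHx|/IHy] [r' [-> eb hr]]; exists r'; split=> //.
  + rewrite {1}eb.
    rewrite (der_ax (A2 gamma x _ y)) (der_ax (A1 gamma (summand a r') y)).
    exact/der_sym/der_ax/A2.
  + by move=> z /hr [hz lt_z]; split=> //; rewrite leq_max lt_z.
  + rewrite {1}eb; exact/der_sym/der_ax/A2.
  + by move=> z /hr [hz lt_z]; split=> //; rewrite leq_max lt_z orbT.
Qed.

(** Each summand of [z] that starts with an action is matched by a step of [y], hence by a summand
    of [y] with a derivably equal continuation, and is absorbed; the others vanish by A6 and A7. The
    second premise is supplied by the induction in [bisim_basic]. *)
Lemma absorb_basic n (z y : acp_term A) : basic z -> basic y ->
  (forall x x', basic x -> basic x' -> depth x < depth z ->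
     depth x' < depth y -> bisim n (emb x) (emb x') -> x == x') ->
  simulates (bisim n) (step (emb z)) (step (emb y)) -> y == y + z.
Proof.
move=> hz hy; elim: hz => [[a|]|[a|] z' hz' _|z1 z2 hz1 IH1 hz2 IH2] IH zy.
- have [r yr rr] := zy a None (conj erefl erefl).
  have [[x|] [re ey _]] := basic_step hy yr; last exact: ey.
  by rewrite re in rr.
- exact/der_sym/der_ax/A6.
- have [|r yr rr] := zy a (Some (emb z')); first by apply/step_prefix.
  have [[x|] [re ey hx]] := basic_step hy yr; rewrite {}re in rr => //.
  have [//|bx lt_x] := hx x.
  have e : z' == x by apply: IH.
  rewrite {1}ey /= e; exact: der_refl.
- rewrite (der_ax (A7 gamma z')); exact/der_sym/der_ax/A6.
- rewrite -(der_ax (A2 gamma y z1 z2)) -IH1 -?IH2.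
  + exact: der_refl.
  + move=> x x' bx bx' lt_x; apply: IH => //.
    by rewrite /= leq_max lt_x orbT.
  + by move=> a r st; apply: zy; right.
  + move=> x x' bx bx' lt_x; apply: IH => //.
    by rewrite /= leq_max lt_x.
  + by move=> a r st; apply: zy; left.
Qed.

Lemma depth_gt0 (x : acp_term A) : 0 < depth x.
Proof. by elim: x => //= x lt_x y _; rewrite leq_max lt_x. Qed.

(** Each term absorbs the other, so both equal their sum. Depths are positive, which makes the base
    case vacuous. *)
Lemma bisim_basic n (x y : acp_term A) : basic x -> basic y ->
  depth x <= n -> depth y <= n -> bisim n (emb x) (emb y) -> x == y.
Proof.
elim: n x y => [|n IH] x y hx hy le_x le_y.
  by have := depth_gt0 x; rewrite ltnNge le_x.
move=> [xy yx].
have yxy : y == y + x.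
  apply: (absorb_basic hx hy _ xy) => u v hu hv lt_u lt_v.
  by apply: IH => //; rewrite -ltnS; apply: leq_trans; eassumption.
have xyx : x == x + y.
  apply: (absorb_basic hy hx _ yx) => u v hu hv lt_u lt_v.
  by apply: IH => //; rewrite -ltnS; apply: leq_trans; eassumption.
exact: der_trans xyx (der_trans (der_ax (A1 gamma x y)) (der_sym yxy)).
Qed.

End Semantics.

Theorem theorem3 (A : Type) (gamma : option A -> option A -> option A)
  (gamma_comm : forall a b, gamma a b = gamma b a)
  (gamma_assoc : forall a b c, gamma a (gamma b c) = gamma (gamma a b) c)
  (gamma_delta : forall a, gamma None a = None)
  (S : Type)
  (sched : forall n : nat, history -> S -> 'I_n.+1)
  (upd : forall n : nat, history -> S -> 'I_n.+1 -> A -> S)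
  (D : Type) (cr : D -> siacp_term A S)
  (cr_closed : forall d, is_closed (cr d))
  (pcr rcr : D -> A)
  (pcr_inj : injective pcr)
  (pcr_gamma : forall d a, gamma (Some (pcr d)) (Some a) = None)
  (gamma_pcr : forall d a b, gamma (Some a) (Some b) <> Some (pcr d))
  (t t' : acp_term A) (t_closed : is_closed t) (t'_closed : is_closed t') :
  siacp_derivable gamma sched upd cr pcr rcr
    (embed (siacp_signature S) t) (embed (siacp_signature S) t') ->
  acp_derivable gamma t t'.
Proof.
move=> tt'.
have [b hb tb] := closed_reducible gamma t_closed.
have [b' hb' tb'] := closed_reducible gamma t'_closed.
(* The larger of the two depths is where bounded bisimilarity is evaluated. *)
have le_b := leq_maxl (depth b) (depth b').
have le_b' := leq_maxr (depth b) (depth b').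
suff bb' : acp_derivable gamma b b'.
  exact: der_trans tb (der_trans bb' (der_sym tb')).
apply: (bisim_basic (sched := sched) (upd := upd) (cr := cr) (pcr := pcr)
  (rcr := rcr) hb hb' le_b le_b').
(* In siACP, [b] is linked to [b'] through [t] and [t'], since derivations in ACP carry over. *)
apply: siacp_derivable_bisim => //.
apply: der_trans (embed_derivable _ _ _ _ _ tb').
apply: der_trans tt'.
exact/der_sym/embed_derivable.
Qed.
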